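(* Let $\mathcal{H}$ be a complex Hilbert space and let $A,B\in\mathcal{B}(\mathcal{H})$ and $\lambda\in\mathbb{C}$ be such that $AB=\lambda BA\neq 0$. Let $M_1,M_2\geq 1$ be real numbers. Then: (1) if $A^*$ is $M_1$-hyponormal and $B$ is $M_2$-hyponormal, then $|\lambda|\leq (M_1M_2)^{1/2}$; (2) if $A$ is $M_1$-hyponormal and $B^*$ is $M_2$-hyponormal, then $|\lambda|\geq (M_1M_2)^{-1/2}$.
   Context: $\mathcal{B}(\mathcal{H})$ denotes the algebra of all bounded linear operators on the complex Hilbert space $\mathcal{H}$. For a real number $M\geq 1$, an operator $T\in\mathcal{B}(\mathcal{H})$ is called $M$-hyponormal if $TT^*\leq M\,T^*T$. *)

(* Defs.v *)
From HB Require Import structures.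
From mathcomp Require Import all_boot all_order all_algebra.
From mathcomp Require Import sesquilinear complex.
From mathcomp Require Import all_classical all_reals all_analysis.

Set Implicit Arguments.
Unset Strict Implicit.
Unset Printing Implicit Defensive.

Import Order.TTheory GRing.Theory Num.Theory Num.Def.
Import numFieldNormedType.Exports.

Local Open Scope ring_scope.
Local Open Scope complex_scope.
Local Open Scope classical_set_scope.

(* The inner product is linear in its first argument. *)
HB.mixin Record CompleteNormedModule_isHilbert (R : realType) H
    of CompleteNormedModule R[i] H := {
  inner : {dot H for (@conjC R[i])} ;
  inner_norm : forall x : H, inner x x = `|x| ^+ 2 }.

#[short(type="hilbertType")]
HB.structure Definition Hilbert (R : realType) :=
  {H of CompleteNormedModule_isHilbert R H & CompleteNormedModule R[i] H}.

Notation "'[ x , y ]" := (inner x y) : ring_scope.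

Section Operators.
Variables (R : realType) (H : hilbertType R).
Implicit Types (S T : H -> H) (M : R).

Definition bounded_op T := exists M, forall x, `|T x| <= M%:C * `|x|.

(* T^* y is the vector z with '[T x, y] = '[x, z] for all x. Such a z is unique,
   and it exists when T is linear and bounded (Riesz representation), so that
   the default value 0 is then never used. *)
Definition adjoint T : H -> H :=
  fun y => xget 0 [set z | forall x, '[T x, y] = '[x, z]].

(* The order on R[i] is partial: 0 <= z says that z is real and nonnegative. *)
Definition le_op S T := forall x, 0 <= '[T x - S x, x].

Definition hyponormal M T :=
  le_op (T \o adjoint T) (M%:C \*: (adjoint T \o T)).

End Operators.

(* Main.v *)
(* Write |S| for the operator norm and let ' denote adjoints.  In case (1) the
   two hypotheses say |A x| <= sqrt M1 |A' x| and |B' x| <= sqrt M2 |B x|, and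
   B'A is the adjoint of A'B, so
     |lambda| |BA| = |AB| <= sqrt M1 |A'B| = sqrt M1 |B'A| <= sqrt (M1 M2) |BA|.
   Case (2) follows on exchanging A and B, as BA = lambda^-1 AB.  The adjoints
   exist by the Riesz representation theorem: the vector representing f is the
   limit of a minimizing sequence of |x|^2 - 2 Re (f x). *)

Require Import Defs.
From mathcomp Require Import all_boot all_order all_algebra complex sesquilinear.
From mathcomp Require Import ring.
From mathcomp Require Import all_classical all_reals all_analysis.

Set Implicit Arguments.
Unset Strict Implicit.
Unset Printing Implicit Defensive.

Import Order.TTheory GRing.Theory Num.Theory.
Import numFieldNormedType.Exports.

Local Open Scope complex_scope.
Local Open Scope classical_set_scope.
Local Open Scope ring_scope.

(** * Scalar inequalities *)

(** A discriminant argument: for [a] equal to [- t] times the conjugate of [c], with [t >= 0], the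
    hypothesis becomes a real quadratic in [t]. It yields both Cauchy-Schwarz and the gradient bound
    in the Riesz theorem. *)
Lemma normsq_le_of_quadratic_ge0 (C : numClosedFieldType) (c e s : C) :
    0 <= e -> 0 <= s ->
    (forall a, 0 <= e + (a * c + (a * c)^*) + `|a| ^+ 2 * s) ->
  `|c| ^+ 2 <= e * s.
Proof.
move=> e0 s0 h.
have [->|c0] := eqVneq c 0; first by rewrite normr0 expr0n mulr_ge0.
set N := `|c| ^+ 2; have N0 : 0 < N by rewrite exprn_gt0// normr_gt0.
have {}h t : 0 <= t -> 0 <= e - t * N *+ 2 + t ^+ 2 * N * s.
  move=> t0; have := h (- (t * c^*)); rewrite normrN normrM norm_conjC.
  have -> : - (t * c^*) * c = - (t * N).
    by rewrite mulNr -mulrA [c^* * c]mulrC -normCK.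
  by rewrite conj_Creal ?realN ?realM ?ger0_real ?(ltW N0)//
    exprMn (ger0_norm t0) mulr2n opprD.
move: s0; rewrite le_eqVlt => /predU1P[s0|s0].
  (* With [s = 0] the quadratic is affine, and this [t] makes it [e - 2 (e + 1) < 0], a
     contradiction. *)
  have /h : 0 <= (e + 1) / N by rewrite divr_ge0 ?addr_ge0// ltW.
  rewrite -s0 !mulr0 addr0 divfK ?gt_eqF// subr_ge0 => /le_lt_trans/(_ _) H.
  have /H : e < (e + 1) *+ 2.
    by rewrite mulr2n -addrA ltrDl addr_gt0// ltr_wpDl.
  by rewrite ltxx.
(* The quadratic is minimal at [t = s^-1]. *)
have /h : 0 <= s^-1 by rewrite invr_ge0 ltW.
have -> : e - s^-1 * N *+ 2 + s^-1 ^+ 2 * N * s = e - N / s.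
  by field; rewrite gt_eqF.
by rewrite subr_ge0 ler_pdivrMr.
Qed.

Lemma addr_conj_le (C : numClosedFieldType) (x : C) : x + x^* <= `|x| *+ 2.
Proof.
have : `|x + x^*| <= `|x| *+ 2 by rewrite mulr2n -{2}(norm_conjC x) ler_normD.
apply: le_trans; apply: real_ler_norm.
by rewrite CrealE rmorphD /= conjCK addrC.
Qed.

Lemma near_invS_ltc (R : realType) (e : R[i]) : 0 < e ->
  \forall n \near \oo, ((n.+1%:R^-1 : R)%:C < e).
Proof.
move=> e0; rewrite -(RRe_real (gtr0_real e0)).
have Re0 : 0 < complex.Re e by move: e0; rewrite ltcE => /andP[].
by near=> n; rewrite ltcR; near: n; exact: (near_infty_natSinv_lt (PosNum Re0)).
Unshelve. all: by end_near. Qed.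

(** If [k < a], then [y <= (k / a) ^+ n * b] for all [n], and the right side tends to 0, against
    [0 < y]. *)
Lemma le_of_expr_bounded (R : realType) (a k b y : R) : 0 < y -> 0 <= k ->
  (forall n, a ^+ n * y <= k ^+ n * b) -> a <= k.
Proof.
move=> y0 k0 h; rewrite leNgt; apply/negP => ka.
have a0 : 0 < a := le_lt_trans k0 ka.
have r1 : `|k / a| < 1.
  by rewrite ger0_norm ?divr_ge0 ?(ltW a0)// ltr_pdivrMr ?mul1r.
suff : y <= 0 by rewrite leNgt y0.
rewrite -[leRHS](mul0r b).
apply: (cvgr_to_ge (cvgM (cvg_expr r1) (cvg_cst b))); apply: nearW => n.
rewrite /= exprMn exprVn mulrAC ler_pdivlMr ?exprn_gt0// mulrC.
exact: h.
Qed.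

(** * The inner product and the Cauchy-Schwarz inequality *)

Section Hilbert.
Variables (R : realType) (H : hilbertType R).
Implicit Types (x y z : H).

Lemma inner_conj x y : '[x, y] = ('[y, x])^*.
Proof. by rewrite hermC expr0 mul1r. Qed.

Lemma inner_addZ x y (a : R[i]) :
  '[x + a *: y, x + a *: y] =
  `|x| ^+ 2 + (a * '[y, x] + (a * '[y, x])^*) + `|a| ^+ 2 * `|y| ^+ 2.
Proof.
rewrite dnormD dnormZ !inner_norm [X in X + X^*]inner_conj conjCK linearZl_LR.
by rewrite [_^* + _]addrC addrAC.
Qed.

Lemma inner_le_norm x y : `|'[x, y]| <= `|x| * `|y|.
Proof.
rewrite -ler_sqr ?nnegrE ?mulr_ge0// exprMn [X in _ <= X]mulrC.
apply: normsq_le_of_quadratic_ge0; rewrite ?exprn_ge0// => a.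
by rewrite -inner_addZ dnorm_ge0.
Qed.

(** * The Riesz representation theorem *)

Section Riesz.
Variables (f : {scalar H}) (c : R[i]).
Hypothesis c0 : 0 <= c.
Hypothesis f_le : forall x, `|f x| <= c * `|x|.

(** If [z] represents [f], then [q x] is [|x - z|^2 - |z|^2], which is minimal at [z]. *)
Let q x := `|x| ^+ 2 - (f x + (f x)^*).

(** The expansion is exact; its linear coefficient vanishes for every [y] exactly when [x]
    represents [f]. *)
Let qD x y a : q (x + a *: y) =
  q x + (a * ('[y, x] - f y) + (a * ('[y, x] - f y))^*) + `|a| ^+ 2 * `|y| ^+ 2.
Proof.
rewrite /q -inner_norm inner_addZ (linearD f) (linearZ_LR f).
by rewrite !(rmorphM, rmorphB, rmorphD) /=; ring.
Qed.

Let q_real x : q x \is Num.real.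
Proof.
rewrite /q realB ?realX ?normr_real//.
by rewrite CrealE rmorphD /= conjCK addrC.
Qed.

(** Completing the square: [q x >= |x|^2 - 2 c |x| = (|x| - c)^2 - c^2]. *)
Let q_ge x : - c ^+ 2 <= q x.
Proof.
have c2 : `|f x| *+ 2 <= c * `|x| *+ 2 by rewrite lerMn2r f_le.
have := le_trans (addr_conj_le (f x)) c2; rewrite /q -subr_ge0 => h.
rewrite -subr_ge0.
have -> : `|x| ^+ 2 - (f x + (f x)^*) - - c ^+ 2 =
  (`|x| - c) ^+ 2 + (c * `|x| *+ 2 - (f x + (f x)^*)) by ring.
by rewrite addr_ge0// real_exprn_even_ge0// realB ?ger0_real.
Qed.

(** The infimum is taken in [R], over real parts, since [R[i]] is only partially ordered; nothing is
    lost as [q] is real-valued. *)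
Let q_inf : exists2 d, (forall x, d <= q x) &
  forall e : R, 0 < e -> exists x, q x <= d + e%:C.
Proof.
pose E := [set complex.Re (q x) | x in [set: H]].
have q_Re x : q x = (complex.Re (q x))%:C by rewrite RRe_real.
have lbE : lbound E (complex.Re (- c ^+ 2)).
  by move=> _ [x _ <-]; have := q_ge x; rewrite lecE => /andP[].
have infE : has_inf E.
  by split; [exists (complex.Re (q 0)), 0|exists (complex.Re (- c ^+ 2))].
exists (inf E)%:C => [x|e e0].
  by rewrite q_Re lecR; apply: ge_inf; [exact: (proj2 infE)|exists x].
have [_ [x _ <-] lt_x] := inf_adherent e0 infE.
by exists x; rewrite q_Re -raddfD lecR ltW.
Qed.

Lemma riesz : exists z, forall x, f x = '[x, z].
Proof.
have [d d_le d_near] := q_inf.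
have dist u v : `|u - v| ^+ 2 <= (q u - d) *+ 2 + (q v - d) *+ 2.
  (* Parallelogram law at the midpoint m of u and v. *)
  pose m := 2^-1 *: (u + v); pose w := 2^-1 *: (u - v).
  have h (a b : H) : 2^-1 *: (a + a) = a.
    have half2 : 2^-1 + 2^-1 = 1 :> R[i] by field.
    by rewrite scalerDr -scalerDl half2 scale1r.
  have -> : q u = q (m + 1 *: w).
    by rewrite scale1r -scalerDr addrACA subrr addr0 h.
  have -> : q v = q (m + (-1) *: w).
    by rewrite scaleN1r -scalerBr opprB addrACA [v + - u]addrC addrACA subrr
      add0r h.
  have -> : `|u - v| = 2 * `|w|.
    by rewrite normrZ mulrA ger0_norm ?invr_ge0// mulfV ?mul1r ?pnatr_eq0.
  rewrite !qD normrN normr1 -subr_ge0.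
  set T := (X in 0 <= X); suff -> : T = (q m - d) *+ 4.
    by rewrite mulrn_wge0// subr_ge0.
  by rewrite /T !(rmorphM, rmorphB, rmorphD, rmorphN, rmorph1) /=; ring.
(* Since [q - d] is nonnegative along every line through [z], the discriminant bounds the gradient
   at [z] by the gap [q z - d]. *)
have grad x z : `|'[x, z] - f x| ^+ 2 <= (q z - d) * `|x| ^+ 2.
  apply: normsq_le_of_quadratic_ge0; rewrite ?exprn_ge0 ?subr_ge0// => a.
  have := d_le (z + a *: x); rewrite qD -subr_ge0.
  by congr (0 <= _); ring.
have /choice[u u_le] :
    forall n : nat, exists x, q x - d <= (n.+1%:R^-1 : R)%:C.
  move=> n; have [|x] := d_near n.+1%:R^-1; rewrite ?invr_gt0//.
  by exists x; rewrite lerBlDl.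
have cvu : cvgn u.
  apply: cauchy_cvg; apply: cauchy_exP => e e0.
  (* [dist] doubles each of two gaps, so gaps below [e ^+ 2 / 4] give a distance below [e]. *)
  have [N _ /(_ _ (leqnn _)) /= N_lt] :
      \forall n \near \oo, ((n.+1%:R^-1 : R)%:C < e ^+ 2 / 4).
    by apply: near_invS_ltc; rewrite divr_gt0 ?exprn_gt0.
  exists (u N); exists N => // n /= Nn; rewrite -ball_normE /=.
  have n_lt : (n.+1%:R^-1 : R)%:C < e ^+ 2 / 4.
    apply: le_lt_trans N_lt; rewrite lecR lef_pV2 ?posrE//.
    by rewrite ler_nat.
  rewrite -ltr_sqr ?nnegrE ?(ltW e0)//.
  apply: (le_lt_trans (dist _ _)).
  have -> : e ^+ 2 = (e ^+ 2 / 4) *+ 2 + (e ^+ 2 / 4) *+ 2 by field.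
  by rewrite ltrD// ltrMn2r/=; apply: le_lt_trans (u_le _) _.
exists (limn u) => x.
apply/eqP; rewrite eq_sym -subr_eq0 -normr_le0; apply/negPn/negP => g0.
set g := `|_| in g0.
have {}g0 : 0 < g by rewrite lt_def normr_ge0 andbT; apply: contraNneq g0 => ->.
(* Each of the two errors below is at most [(g / k) * |x|]; the [+ 1] makes their sum less than [g],
   and keeps [k] positive when [x = 0]. *)
pose k := `|x| *+ 2 + 1; have k0 : 0 < k by rewrite ltr_wpDl// mulrn_wge0.
have e0 : 0 < g / k by rewrite divr_gt0.
have [n [n_u n_lt]] : exists n,
    `|limn u - u n| < g / k /\ (n.+1%:R^-1 : R)%:C < (g / k) ^+ 2.
  near \oo => n; exists n; split; near: n.
    by move/cvgrPdist_lt: cvu; apply.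
  by apply: near_invS_ltc; rewrite exprn_gt0.
have g_le : g <= `|'[x, limn u - u n]| + `|'[x, u n] - f x|.
  by apply: le_trans (ler_normD _ _); rewrite linearBr addrA subrK.
have : g <= (g / k) * (`|x| *+ 2).
  apply: (le_trans g_le); rewrite mulrnAr mulr2n lerD//.
    by apply: le_trans (inner_le_norm _ _) _; rewrite mulrC ler_wpM2r// ltW.
  rewrite -ler_sqr ?nnegrE ?(mulr_ge0 (ltW e0))//.
  apply: (le_trans (grad _ _)).
  by rewrite exprMn ler_wpM2r ?exprn_ge0//; exact/ltW/(le_lt_trans (u_le n)).
rewrite mulrAC ler_pdivlMr// ler_pM2l// /k.
by rewrite gerDl ler10.
Unshelve. all: by end_near. Qed.

End Riesz.

(** * Adjoints *)

Lemma inner_inj y z : (forall x, '[x, y] = '[x, z]) -> y = z.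
Proof.
move=> /(_ (y - z))/eqP; rewrite -subr_eq0 -linearBr dnorm_eq0 subr_eq0.
by move/eqP.
Qed.

Lemma adjoint_sym (S T : H -> H) :
  (forall x y, '[S x, y] = '[x, T y]) -> forall x y, '[T x, y] = '[x, S y].
Proof. by move=> ST x y; rewrite inner_conj -ST -inner_conj. Qed.

(** Any map satisfying the adjunction is the adjoint; this will identify [adjoint (adjoint A)] with
    [A]. *)
Lemma adjoint_eq (S T : H -> H) :
  (forall x y, '[S x, y] = '[x, T y]) -> adjoint S = T.
Proof.
move=> ST; apply/funext => y; apply: xget_unique => [x|z /= Sz].
  exact: ST.
by apply: inner_inj => x; rewrite -Sz ST.
Qed.

Lemma innerA_adjoint (A : {linear H -> H}) x y :
  bounded_op A -> '[A x, y] = '[x, adjoint A y].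
Proof.
move=> [M bA]; pose f : {scalar H} := applyr (@inner R H) y \o A.
(* [bounded_op] does not fix the sign of [M], hence the absolute value. *)
have c0 : 0 <= `|M%:C| * `|y| by rewrite mulr_ge0.
have [|z fz] := riesz (f := f) c0.
  move=> x'; apply: le_trans (inner_le_norm (A x') y) _.
  rewrite mulrAC ler_wpM2r//; apply: le_trans (bA _) _.
  by rewrite ler_wpM2r// real_ler_norm// complex_real.
rewrite /adjoint; case: xgetP => [z' _ -> //|/(_ z) []] /= x'.
exact: fz.
Qed.

Lemma inner_adjointA (A : {linear H -> H}) x y :
  bounded_op A -> '[adjoint A x, y] = '[x, A y].
Proof. by move=> bA; apply: adjoint_sym => {}x {}y; exact: innerA_adjoint. Qed.

(** Cauchy-Schwarz gives [|T x|^2 = '[S (T x), x] <= c |T x| |x|], and [|T x|] cancels when it is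
    nonzero. *)
Lemma adjoint_le (S T : H -> H) (c : R[i]) : 0 <= c ->
  (forall x y, '[S x, y] = '[x, T y]) ->
  (forall x, `|S x| <= c * `|x|) -> forall x, `|T x| <= c * `|x|.
Proof.
move=> c0 ST S_le x; have [->|Tx0] := eqVneq (`|T x|) 0; first by rewrite mulr_ge0.
have Tx_gt0 : 0 < `|T x| by rewrite lt_def Tx0 /=.
rewrite -(ler_pM2l Tx_gt0) -expr2 -inner_norm -ST.
have Sc : `|'[S (T x), x]| <= `|S (T x)| * `|x| := inner_le_norm _ _.
rewrite -[leLHS]ger0_norm ?ST ?dnorm_ge0// -ST.
by apply: (le_trans Sc); rewrite mulrCA mulrA ler_wpM2r.
Qed.

(** * Hyponormality and the bound on the commutation factor *)

(** Evaluated at [x], the operator inequality reads [0 <= M |S x|^2 - |T x|^2]. *)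
Lemma hyponormal_le (M : R) (S T : H -> H) : 0 <= M ->
  (forall x y, '[S x, y] = '[x, T y]) ->
  hyponormal M S -> forall x, `|T x| <= (Num.sqrt M)%:C * `|S x|.
Proof.
move=> M0 ST + x => /(_ x).
rewrite /= (adjoint_eq ST).
have -> : '[M%:C *: T (S x) - S (T x), x] = M%:C * `|S x| ^+ 2 - `|T x| ^+ 2.
  by rewrite -!inner_norm -(adjoint_sym ST) -ST linearBl [X in X - _]linearZl_LR.
rewrite subr_ge0 => h; rewrite -ler_sqr ?nnegrE ?mulr_ge0 ?ler0c ?sqrtr_ge0//.
by rewrite exprMn -rmorphXn/= sqr_sqrtr.
Qed.

(* The operator norm of BA is replaced by an arbitrary bound c, which each pass
   through the chain of inequalities improves by the factor k1 k2 / |mu|. *)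
Lemma commutation_bound (A B A' B' : H -> H) (mu : R[i]) (c k1 k2 : R) :
  0 <= k1 -> 0 <= k2 -> 0 <= c ->
  (forall x y, '[A x, y] = '[x, A' y]) ->
  (forall x y, '[B' x, y] = '[x, B y]) ->
  (forall x, `|A x| <= k1%:C * `|A' x|) ->
  (forall x, `|B' x| <= k2%:C * `|B x|) ->
  (forall x, A (B x) = mu *: B (A x)) ->
  (forall x, `|B (A x)| <= c%:C * `|x|) ->
  forall n x, `|mu| ^+ n * `|B (A x)| <= ((k1 * k2) ^+ n * c)%:C * `|x|.
Proof.
move=> k10 k20 c0 adjA adjB A_le B_le AB BA_le.
elim=> [|n IH] x; first by rewrite expr0 !mul1r.
have k_ge0 (k : R) : 0 <= k -> 0 <= k%:C by rewrite ler0c.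
have B'A_le z : `|mu| ^+ n * `|B' (A z)| <= (k2 * ((k1 * k2) ^+ n * c))%:C * `|z|.
  rewrite rmorphM/= -mulrA; apply: le_trans (ler_wpM2l (k_ge0 _ k20) (IH z)).
  by rewrite [leRHS]mulrCA ler_wpM2l ?exprn_ge0.
have A'B_le z : `|mu| ^+ n * `|A' (B z)| <= (k2 * ((k1 * k2) ^+ n * c))%:C * `|z|.
  have K0 : 0 <= (k2 * ((k1 * k2) ^+ n * c))%:C.
    by rewrite ler0c !mulr_ge0// exprn_ge0 ?mulr_ge0.
  (* The power of [mu] is put inside the operators, with its conjugate on the adjoint side, so that
     [adjoint_le] carries the weighted bound from [B' A] to [A' B]. *)
  pose S z := mu ^+ n *: B' (A z); pose T z := (mu ^+ n)^* *: A' (B z).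
  have ST u v : '[S u, v] = '[u, T v].
    rewrite /S /T linearZl_LR linearZr_LR /= conjCK; congr (_ * _).
    by rewrite adjB adjA.
  have := adjoint_le K0 ST _ z; rewrite normrZ norm_conjC normrX; apply => u.
  by rewrite normrZ normrX.
rewrite exprS -mulrA mulrCA -normrZ -AB.
apply: le_trans (ler_wpM2l _ (A_le _)) _; rewrite ?exprn_ge0//.
rewrite mulrCA; apply: le_trans (ler_wpM2l (k_ge0 _ k10) (A'B_le _)) _.
by rewrite [leLHS]mulrA -rmorphM/= exprS !mulrA.
Qed.

Lemma commutation_norm_le (A B A' B' : H -> H) (mu : R[i]) (c k1 k2 : R) x0 :
  0 <= k1 -> 0 <= k2 -> 0 <= c ->
  (forall x y, '[A x, y] = '[x, A' y]) ->
  (forall x y, '[B' x, y] = '[x, B y]) ->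
  (forall x, `|A x| <= k1%:C * `|A' x|) ->
  (forall x, `|B' x| <= k2%:C * `|B x|) ->
  (forall x, A (B x) = mu *: B (A x)) ->
  (forall x, `|B (A x)| <= c%:C * `|x|) ->
  B (A x0) != 0 -> `|mu| <= (k1 * k2)%:C.
Proof.
move=> k10 k20 c0 adjA adjB A_le B_le AB BA_le BA0.
have h := commutation_bound k10 k20 c0 adjA adjB A_le B_le AB BA_le.
(* Norms take values in [R[i]]; they are moved to [R], where powers are compared. *)
have [m mE] := complex_realP _ (normr_real mu).
have [y yE] := complex_realP _ (normr_real (B (A x0))).
have [r rE] := complex_realP _ (normr_real x0).
rewrite mE lecR; apply: (@le_of_expr_bounded _ _ _ (c * r) y).
- by rewrite -ltcR -yE normr_gt0.
- exact: mulr_ge0.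
- move=> n; have := h n x0; rewrite mE yE rE -rmorphXn -!rmorphM/= lecR.
  by rewrite mulrA.
Qed.

Lemma bounded_op_comp (A B : H -> H) : bounded_op A -> bounded_op B ->
  exists2 c : R, 0 <= c & forall x, `|B (A x)| <= c%:C * `|x|.
Proof.
move=> [a bA] [b bB]; exists (`|b| * `|a|); first exact: mulr_ge0.
have abs (T : H -> H) m : (forall x, `|T x| <= m%:C * `|x|) ->
    forall x, `|T x| <= `|m|%:C * `|x|.
  by move=> bT x; apply: le_trans (bT x) _; rewrite ler_wpM2r// lecR ler_norm.
move=> x; apply: le_trans (abs _ _ bB _) _.
by rewrite rmorphM/= -mulrA ler_wpM2l ?ler0c//; exact: abs.
Qed.

End Hilbert.

Theorem theorem2p5 (R : realType) (H : hilbertType R)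
    (A B : {linear H -> H}) (lambda : R[i]) (M1 M2 : R)
    (bA : bounded_op A) (bB : bounded_op B)
    (AB : A \o B = lambda \*: (B \o A)) (AB_neq0 : A \o B <> (fun=> 0))
    (M1_ge1 : 1 <= M1) (M2_ge1 : 1 <= M2) :
  (hyponormal M1 (adjoint A) -> hyponormal M2 B ->
     `|lambda| <= (Num.sqrt (M1 * M2))%:C) /\
  (hyponormal M1 A -> hyponormal M2 (adjoint B) ->
     ((Num.sqrt (M1 * M2))^-1)%:C <= `|lambda|).
Proof.
have M10 : 0 <= M1 := le_trans ler01 M1_ge1.
have M20 : 0 <= M2 := le_trans ler01 M2_ge1.
have ABx x : A (B x) = lambda *: B (A x) := congr1 (fun f => f x) AB.
have [x0 ABx0] : exists x, A (B x) != 0.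
  apply/not_existsP => h; apply: AB_neq0; apply/funext => x /=.
  by apply/eqP; rewrite -[_ == _]negbK; apply/negP/h.
have [lambda0 BAx0] : lambda != 0 /\ B (A x0) != 0.
  by apply/andP; rewrite -negb_or -scaler_eq0 -ABx.
have aA x y : '[A x, y] = '[x, adjoint A y] := innerA_adjoint x y bA.
have aB x y : '[B x, y] = '[x, adjoint B y] := innerA_adjoint x y bB.
have aA' x y : '[adjoint A x, y] = '[x, A y] := inner_adjointA x y bA.
have aB' x y : '[adjoint B x, y] = '[x, B y] := inner_adjointA x y bB.
rewrite sqrtrM//; split=> hA hB.
  have [c c0 BA_le] := bounded_op_comp bA bB.
  apply: (commutation_norm_le _ _ c0 aA aB' _ _ ABx BA_le BAx0); rewrite ?sqrtr_ge0//.
  - exact: hyponormal_le hA.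
  - exact: hyponormal_le hB.
have [c c0 AB_le] := bounded_op_comp bB bA.
have BAx x : B (A x) = lambda^-1 *: A (B x).
  by rewrite ABx scalerA mulVf ?scale1r.
(* The roles of [A] and [B] are exchanged, with factor [lambda^-1]; the nonzero vector is now
   [A (B x0)]. *)
have : `|lambda^-1| <= (Num.sqrt M2 * Num.sqrt M1)%:C.
  apply: (commutation_norm_le _ _ c0 aB aA' _ _ BAx AB_le ABx0); rewrite ?sqrtr_ge0//.
  - exact: hyponormal_le hB.
  - exact: hyponormal_le hA.
rewrite mulrC normfV => h; rewrite fmorphV/=.
rewrite -[leRHS]invrK lef_pV2 ?posrE ?invr_gt0 ?normr_gt0//.
by rewrite ltcR mulr_gt0// sqrtr_gt0 (lt_le_trans ltr01).
Qed.
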